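(* Let $K:(-\infty,\infty)\times(-\infty,\infty)\to(-\infty,\infty)$ be a symmetric, homogeneous and twice differentiable mean and let $r$ be a real function defined on $(0,\infty)$ with $\lim_{x\to\infty}r(x)=0$. Then for fixed real numbers $\epsilon,\epsilon^{\ast}$ with $\epsilon+\epsilon^{\ast}=1$, we have $$\Gamma(x+1)\sim\sqrt{2\pi}\left(x+\frac12\right)^{K(x+\epsilon,x+\epsilon^{\ast})}e^{-(x+1/2)}\,e^{r(x)}\quad\text{as }x\to\infty.$$
   Context: $\Gamma$ is Euler's gamma function. For an interval $I\subseteq\mathbb{R}$, a function $K:I^2\to\mathbb{R}$ is a (bivariate) mean if $\min(a,b)\le K(a,b)\le\max(a,b)$ for all $a,b\in I$. It is symmetric if $K(a,b)=K(b,a)$ for all $a,b\in I$, and homogeneous (of degree one) if $K(ta,tb)=tK(a,b)$ for all $a,b\in I$ and $t>0$. Twice differentiable means twice differentiable as a function of two variables. The notation $f(x)\sim g(x)$ as $x\to\infty$ means $\lim_{x\to\infty}f(x)/g(x)=1$. *)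

(* Defs.v *)
From HB Require Import structures.
From mathcomp Require Import all_boot all_order all_algebra.
From mathcomp Require Import all_classical all_reals all_analysis.
Set Implicit Arguments.
Unset Strict Implicit.
Unset Printing Implicit Defensive.
Import Order.TTheory GRing.Theory Num.Theory.
Import numFieldNormedType.Exports.
Local Open Scope classical_set_scope.
Local Open Scope ring_scope.

(* Euler's integral: this is the gamma function on x > 0, where the integral
   converges. For x <= 0 it is not the analytic continuation. *)
Definition Gamma (R : realType) (x : R) : R :=
  \int[lebesgue_measure]_(t in `]0, +oo[) (t `^ (x - 1) * expR (- t)).

Definition bivariate_mean (R : realType) (K : R * R -> R) : Prop :=
  forall a b, Num.min a b <= K (a, b) <= Num.max a b.

Definition symmetric_mean (R : realType) (K : R * R -> R) : Prop :=
  forall a b, K (a, b) = K (b, a).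

Definition homogeneous_mean (R : realType) (K : R * R -> R) : Prop :=
  forall a b t, 0 < t -> K (t * a, t * b) = t * K (a, b).

Definition gradient2 (R : realType) (K : R * R -> R) (p : R * R) : R * R :=
  ('d K p (1, 0), 'd K p (0, 1)).

(* The library has no normed space of linear maps R^2 -> R, so the total
   derivative p |-> 'd K p is represented by its coordinates in the dual
   canonical basis. [differentiable] is Frechet differentiability. *)
Definition twice_differentiable2 (R : realType) (K : R * R -> R) : Prop :=
  (forall p, differentiable K p) /\ (forall p, differentiable (gradient2 K) p).

(* f(x) ~ g(x) as x -> +oo *)
Definition asymp_equiv (R : realType) (f g : R -> R) : Prop :=
  f x / g x @[x --> +oo] --> (1 : R).

(* Main.v *)
(** A homogeneous function that is differentiable at the origin coincides with
    its differential there, so it is linear; a linear symmetric mean is the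
    arithmetic mean.  Hence [K (x + eps, x + eps') = x + 1/2] and the statement
    reduces to Stirling's formula, which is obtained by Laplace's method: with
    [v = sqrt x], the substitution [t = v^2 + v s] turns [Gamma (x + 1)] into
    [x^(x + 1/2) e^(-x)] times the integral of [(1 + s/v)^(v^2) e^(-v s)], which
    tends to the Gaussian integral by dominated convergence. *)
Require Import Defs.
From HB Require Import structures.
From mathcomp Require Import all_boot all_order all_algebra.
From mathcomp Require Import all_classical all_reals all_analysis.
From mathcomp Require Import measurable_realfun ring lra.
Import Order.TTheory GRing.Theory Num.Theory.
Import numFieldNormedType.Exports.
Local Open Scope classical_set_scope.
Local Open Scope ring_scope.

(** * Homogeneous means differentiable at the origin *)

(** For [t > 0] homogeneity makes the difference quotient at 0 in direction [p] constantly [K p], so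
    the right-hand limit already identifies the directional derivative. *)
Lemma diff_homogeneous (R : realType) (K : R * R -> R) :
  differentiable K 0 -> homogeneous_mean K -> K 0 = 0 ->
  forall p, 'd K 0 p = K p.
Proof.
move=> dK hK K0 [a b].
have /cvg_dnbhs_at_right dKp := diff_derivable (v := (a, b)) dK.
rewrite -deriveE//; apply: (cvg_unique _ dKp) => //.
apply: (@cvg_trans _ (cst (K (a, b)) @ 0^'+)); last exact: cvg_cst.
apply: near_eq_cvg; near=> t.
have t0 : 0 < t by near: t; exact: nbhs_right_gt.
rewrite /= addr0 K0 subr0 (_ : t *: (a, b) = (t * a, t * b))// hK//.
by rewrite /GRing.scale/= mulKf// gt_eqF.
Unshelve. all: end_near. Qed.

Lemma homogeneous_mean_arithmetic (R : realType) (K : R * R -> R) :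
  bivariate_mean K -> symmetric_mean K -> homogeneous_mean K ->
  differentiable K 0 -> forall a b, K (a, b) = (a + b) / 2.
Proof.
move=> Kmean Ksym Khom dK a b.
have Kdiag c : K (c, c) = c.
  by have := Kmean c c; rewrite minxx maxxx -eq_le => /eqP.
have dE := diff_homogeneous _ _ dK Khom (Kdiag 0).
have Klin x y : K (x, y) = x * K (1, 0) + y * K (0, 1).
  rewrite -!dE -[x * _]/(x *: _) -[y * _]/(y *: _) -!linearZ -linearD.
  by congr ('d K 0 (_, _)); rewrite /= /GRing.scale/= ?mulr1 ?mulr0 ?addr0 ?add0r.
have K01 : K (0, 1) = 1 / 2 by have := Klin 1 1; rewrite Kdiag (Ksym 1 0); lra.
rewrite Klin (Ksym 1 0) K01; lra.
Qed.

(** * Quantitative bounds on the logarithm *)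

(** Apply [ln z <= z - 1] at [z = sqrt y] and use [ln y = 2 ln z]. *)
Lemma subr1_sub_ln_ge (R : realType) (y : R) : 0 < y ->
  (Num.sqrt y - 1) ^+ 2 <= y - 1 - ln y.
Proof.
move=> y0.
have s0 : 0 < Num.sqrt y by rewrite sqrtr_gt0.
have -> : ln y = ln (Num.sqrt y) *+ 2 by rewrite -lnXn// sqr_sqrtr ?ltW.
have : ln (Num.sqrt y) <= Num.sqrt y - 1.
  by have := @le_ln1Dx R (Num.sqrt y - 1); rewrite (addrC 1) subrK; apply; lra.
have := sqr_sqrtr (ltW y0); rewrite mulr2n !expr2; lra.
Qed.

(** With [s = sqrt (1 + u)], [u = (s - 1)(s + 1)] and [(s + 1)^2 <= 2 (s^2 + 1) = 2 (2 + u)]. The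
    deficit is quadratic near 0 and linear at infinity, which later yields an exponentially decaying
    dominating function. *)
Lemma ln1D_ub (R : realType) (u : R) : -1 < u ->
  ln (1 + u) <= u - u ^+ 2 / (2 * (2 + u)).
Proof.
move=> u1.
have := @subr1_sub_ln_ge R (1 + u) ltac:(lra).
have := @sqr_sqrtr R (1 + u) ltac:(lra).
set s := Num.sqrt _ => sE.
have s0 : 0 <= s by exact: sqrtr_ge0.
suff : u ^+ 2 / (2 * (2 + u)) <= (s - 1) ^+ 2 by lra.
rewrite ler_pdivrMr; last lra.
have -> : u = s ^+ 2 - 1 by lra.
rewrite -subr_ge0.
have -> : (s - 1) ^+ 2 * (2 * (2 + (s ^+ 2 - 1))) - (s ^+ 2 - 1) ^+ 2
  = ((s - 1) ^+ 2) ^+ 2 by ring.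
exact: sqr_ge0.
Qed.

(** The remainder vanishes at 0 and has derivative [x^2 / (1 + x)], at most [2 u^2] in absolute
    value between 0 and [u]; the mean value theorem concludes, on [[0, u]] or [[u, 0]] according to
    the sign of [u]. *)
Lemma ln1D_remainder (R : realType) (u : R) : `|u| <= 1 / 2 ->
  `|ln (1 + u) - (u - u ^+ 2 / 2)| <= 2 * `|u| ^+ 3.
Proof.
move=> u12.
pose f (x : R) := ln (1 + x) - (x - x ^+ 2 / 2).
pose df (x : R) := x ^+ 2 / (1 + x).
have f0 : f 0 = 0 by rewrite /f addr0 ln1 expr2; lra.
have fdf (x : R) : -1 < x -> is_derive x 1 f (df x).
  move=> x1; have x0 : 0 < 1 + x by lra.
  have dln : is_derive x 1 (fun y : R => ln (1 + y)) (1 + x)^-1.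
    have d1 : is_derive x 1 (fun y : R => 1 + y) 1.
      by apply: is_derive_eq; rewrite add0r mulr1.
    by have := is_derive1_comp (is_derive1_ln x0) d1; rewrite mulr1.
  have dq : is_derive x 1 (fun y : R => y - y ^+ 2 / 2) (1 - x).
    by apply: is_derive_eq; rewrite /GRing.scale/=; field.
  apply: (is_derive_eq (is_deriveB dln dq)).
  by rewrite /df; field; rewrite gt_eqF.
have dfle (x : R) : `|x| <= `|u| -> `|df x| <= 2 * `|u| ^+ 2.
  move=> xu; have x0 : 1 / 2 <= 1 + x by have := ler_norm (- x); rewrite normrN; lra.
  rewrite /df normrM normrX normfV (@ger0_norm _ (1 + x)); last lra.
  rewrite ler_pdivrMr; last lra.
  have : `|x| ^+ 2 <= `|u| ^+ 2 by rewrite ler_pXn2r// nnegrE.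
  have := sqr_ge0 `|u|; nra.
have fc (a b : R) : -1 < a -> {within `[a, b], continuous f}.
  move=> a1; apply: derivable_within_continuous => x.
  rewrite in_itv /= => /andP[ax _].
  by case: (fdf x) => //; lra.
have mvt (a b : R) : a <= b -> -1 < a -> (forall x, a <= x <= b -> `|x| <= `|u|) ->
   `|f b - f a| <= 2 * `|u| ^+ 2 * (b - a).
  move=> ab a1 H.
  have [||c] := @MVT_segment R f df a b ab.
  - by move=> x; rewrite in_itv /= => /andP[ax _]; apply: fdf; lra.
  - exact: fc.
  - rewrite in_itv/= => cab ->; rewrite normrM (@ger0_norm _ (b - a)) ?subr_ge0//.
    by rewrite ler_wpM2r ?subr_ge0 ?dfle ?H.
rewrite -[X in `|X|]/(f u).
have [u0|u0] := leP 0 u.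
  have := @mvt 0 u u0 ltac:(lra).
  rewrite f0 !subr0 (ger0_norm u0) => /(_ _)/le_trans; apply.
    by move=> x /andP[x0 xu]; rewrite ger0_norm.
  by rewrite (exprS _ 2); lra.
have un : `|u| = - u by rewrite ltr0_norm.
rewrite un in u12 *.
have := @mvt u 0 (ltW u0) ltac:(lra).
rewrite f0 !sub0r normrN un => /(_ _)/le_trans; apply.
  by move=> x /andP[x0 xu]; rewrite ler0_norm// lerN2.
by rewrite (exprS _ 2); lra.
Qed.

(** * Continuity and reference integrals *)

(** Substitution over the whole line asks for a continuous integrand; as [x > 0], the power glues
    continuously at 0 to the zero function on the left. *)
Lemma powR_max0_continuous (R : realType) (x : R) : 0 < x ->
  continuous (fun t : R => Num.max t 0 `^ x).
Proof.
move=> x0 t; have [t0|t0|->] := ltgtP t 0.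
- rewrite /continuous_at max_r ?(ltW t0)// powR0 ?gt_eqF//.
  apply: cvg_near_cst; near=> y.
  rewrite max_r ?powR0 ?gt_eqF//.
  near: y; exact: lt_le_nbhsl.
- have : {for t, continuous (fun y : R => y `^ x)}.
    apply: differentiable_continuous; apply/derivable1_diffP.
    by apply: derivable_powR; rewrite in_itv/= andbT.
  rewrite /continuous_at max_l ?(ltW t0)//; apply: cvg_trans.
  apply: near_eq_cvg; near=> y; rewrite max_l//.
  near: y; exact: lt_le_nbhsr.
- rewrite /continuous_at maxxx powR0 ?gt_eqF//.
  suff : Num.max y 0 `^ x @[y --> (0 : R)] --> Num.max 0 0 `^ x.
    by rewrite maxxx powR0 ?gt_eqF.
  apply/left_right_continuousP; rewrite maxxx powR0 ?gt_eqF//; split.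
    apply: cvg_near_cst; near=> y.
    rewrite max_r ?powR0 ?gt_eqF//.
  apply: cvg_trans (powR_cvg0 x0); apply: near_eq_cvg; near=> y.
  by rewrite max_l.
Unshelve. all: end_near. Qed.

(** The standard normal density has mass 1; divide by its peak value. *)
Lemma integralT_gauss_half (R : realType) :
  (\int[lebesgue_measure]_x (expR (- x ^+ 2 / 2) : R)%:E =
   (Num.sqrt (2 * pi))%:E)%E.
Proof.
have := integral_normal_pdf (0 : R) 1; rewrite normal_pdfE ?oner_neq0//.
under eq_integral do rewrite EFinM.
rewrite ge0_integralZl//=; last 3 first.
- by apply/measurable_EFinP; exact: measurable_normal_fun.
- by move=> x _; rewrite lee_fin normal_fun_ge0.
- by rewrite lee_fin normal_peak_ge0.
have p0 := @normal_peak_gt0 R 1 (oner_neq0 _).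
under eq_integral do rewrite /normal_fun subr0 expr1n.
set I := integral _ _ _ => /(congr1 (fun e => (normal_peak 1)^-1%:E * e)%E).
rewrite muleA -EFinM mulVf ?gt_eqF// mul1e mule1 => ->.
by rewrite /normal_peak invrK expr1n mul1r mulr_natl.
Qed.

(** This is the dominating function for Laplace's method. By evenness it reduces to the half-line,
    where it is [2 e] times the exponential density of rate 1/2. *)
Lemma integrable_expR_abs (R : realType) :
  lebesgue_measure.-integrable setT (fun s : R => (expR (1 - `|s| / 2))%:E).
Proof.
have cE : continuous (fun s : R => expR (1 - `|s| / 2)).
  move=> s; apply: (@continuous_comp _ _ _ (fun s : R => 1 - `|s| / 2) expR).
    apply: continuousB; first exact: cvg_cst.
    by apply: continuousM; [exact: norm_continuous|exact: cvg_cst].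
  exact: continuous_expR.
apply/integrableP; split.
  by apply/measurable_EFinP; exact: continuous_measurable_fun.
under eq_integral do rewrite /= ger0_norm ?expR_ge0//.
rewrite ge0_symfun_integralT//; last first.
  by move=> s /=; rewrite normrN.
apply: lte_mul_pinfty => //.
have h0 : (0 : R) < 1 / 2 by [].
have pdf0 := @exponential_pdf_ge0 R _ (ltW h0).
have mpdf := measurable_exponential_pdf (1 / 2 : R).
apply: (@le_lt_trans _ _
  (\int[lebesgue_measure]_x ((2 * expR 1)%:E * (exponential_pdf (1 / 2 : R) x)%:E)))%E.
  rewrite integral_mkcond; apply: ge0_le_integral => //.
  - by move=> x _; rewrite /patch; case: ifP => // _; rewrite lee_fin expR_ge0.
  - apply/(measurable_restrictT _ _).1; first by rewrite -set_itvcy.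
    by apply/measurable_EFinP/measurable_funTS; exact: continuous_measurable_fun.
  - by apply: measurable_funeM; apply/measurable_EFinP.
  - move=> x _; rewrite /patch; case: ifPn => [|_].
      rewrite inE /= => x0; rewrite -EFinM lee_fin exponential_pdfE// ger0_norm// expRD.
      rewrite (_ : - (1 / 2) * x = - (x / 2)); last by field.
      by rewrite (_ : 2 * _ * _ = expR 1 * expR (- (x / 2)))//; field.
    by rewrite -EFinM lee_fin mulr_ge0 ?mulr_ge0 ?expR_ge0.
rewrite ge0_integralZl//=.
- by rewrite integral_exponential_pdf// mule1 ltry.
- by apply/measurable_EFinP.
- by move=> x _; rewrite lee_fin.
Qed.

(** * The rescaled integrand: domination and pointwise limit *)

Lemma cvgV0_pinfty (R : realType) : (v : R)^-1 @[v --> +oo] --> (0 : R).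
Proof.
apply: (gtr0_cvgV0 _).2; last exact: cvg_id.
by apply: nbhs_pinfty_gt; exact: num_real.
Qed.

(* The integrand of [Gamma (v ^+ 2 + 1)] after the substitution
   [t = v ^+ 2 + v * s], divided by its value at [s = 0]; the maximum extends it
   by 0 to the [s] with [t <= 0], where [powR] would otherwise take junk
   values. *)
Definition laplace_fun (R : realType) (v s : R) : R :=
  Num.max (1 + s / v) 0 `^ (v ^+ 2) * expR (- (v * s)).

Lemma laplace_fun_ge0 (R : realType) (v s : R) : 0 <= laplace_fun R v s.
Proof. by rewrite mulr_ge0 ?powR_ge0 ?expR_ge0. Qed.

Lemma laplace_funE (R : realType) (v s : R) : 0 < 1 + s / v ->
  laplace_fun R v s = expR (v ^+ 2 * ln (1 + s / v) - v * s).
Proof.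
by move=> s0; rewrite /laplace_fun max_l ?ltW// /powR gt_eqF// -expRD.
Qed.

Lemma powR_max0_expR_continuous (R : realType) (p : R) : 0 < p ->
  continuous (fun t : R => Num.max t 0 `^ p * expR (- t)).
Proof.
move=> p0 t; apply: cvgM; first exact: powR_max0_continuous.
by apply: continuous_comp; [exact: opp_continuous|exact: continuous_expR].
Qed.

Lemma laplace_fun_continuous (R : realType) (v : R) : 0 < v ->
  continuous (laplace_fun R v).
Proof.
move=> v0 s; apply: cvgM.
  have c1 : {for s, continuous (fun s : R => 1 + s / v)}.
    by apply: cvgD; [exact: cvg_cst|apply: cvgMr_tmp; exact: cvg_id].
  have v20 : 0 < v ^+ 2 by rewrite exprn_gt0.
  exact: (cvg_comp _ _ c1 (@powR_max0_continuous R _ v20 _)).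
have c2 : {for s, continuous (fun s : R => - (v * s))}.
  by apply: cvgN; apply: cvgMl_tmp; exact: cvg_id.
exact: (cvg_comp _ _ c2 (@continuous_expR R _)).
Qed.

(** The bound is uniform in [v], as domination requires: for [u = s / v], [ln1D_ub] makes the
    exponent at most [- s^2 / (4 + 2 u)], and [v >= 1] gives [u <= |s|]. *)
Lemma laplace_fun_le (R : realType) (v s : R) : 1 <= v ->
  laplace_fun R v s <= expR (1 - `|s| / 2).
Proof.
move=> v1; have v0 : 0 < v by lra.
have [y0|y0] := ltP 0 (1 + s / v); last first.
  by rewrite /laplace_fun max_r// powR0 ?expf_neq0 ?gt_eqF// mul0r expR_ge0.
rewrite laplace_funE// ler_expR.
set u := s / v in y0 *.
have sE : s = u * v by rewrite /u divfK ?gt_eqF.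
clearbody u.
have := @ln1D_ub R u ltac:(lra).
move=> /(ler_wpM2l (sqr_ge0 v)) lnu.
have us : `|u| <= `|s|.
  by rewrite sE normrM ler_peMr// ger0_norm// ltW.
have : s ^+ 2 / (4 + 2 * `|s|) <= v ^+ 2 * (u ^+ 2 / (2 * (2 + u))).
  rewrite mulrA -exprMn (mulrC v) -sE ler_wpM2l ?sqr_ge0//.
  rewrite lef_pV2 ?posrE; last 2 first.
  - by have := normr_ge0 s; lra.
  - lra.
  by have := ler_norm u; lra.
(* Holds because [(|s| / 2 - 1) (4 + 2 |s|) = s^2 - 4]. *)
have : `|s| / 2 - 1 <= s ^+ 2 / (4 + 2 * `|s|).
  have s0 := normr_ge0 s; rewrite ler_pdivlMr; last by lra.
  by rewrite -(real_normK (num_real s)); lra.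
have : v * s = v ^+ 2 * u by rewrite sE; ring.
move: lnu; rewrite mulrBr; lra.
Qed.

(** Second-order expansion of the logarithm: the terms [v * s] cancel, and the exponent differs from
    [- s^2 / 2] by at most [2 |s|^3 / v]. *)
Lemma laplace_fun_cvg (R : realType) (s : R) :
  laplace_fun R v s @[v --> +oo] --> expR (- s ^+ 2 / 2).
Proof.
suff : expR (v ^+ 2 * ln (1 + s / v) - v * s) @[v --> +oo]
    --> expR (- s ^+ 2 / 2).
  apply: cvg_trans; apply: near_eq_cvg; near=> v.
  have v0 : 0 < v by near: v; apply: nbhs_pinfty_gt; exact: num_real.
  have vs : `|s| < v by near: v; apply: nbhs_pinfty_gt; exact: num_real.
  rewrite laplace_funE//.
  suff : - s / v < 1 by lra.
  by rewrite ltr_pdivrMr// mul1r (le_lt_trans (ler_norm _))// normrN.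
apply: (@continuous_cvg _ _ _ _ _ _ expR); first exact: continuous_expR.
apply: (@squeeze_cvgr _ _ _ _ (fun v => - s ^+ 2 / 2 - 2 * `|s| ^+ 3 * v^-1)
  (fun v => - s ^+ 2 / 2 + 2 * `|s| ^+ 3 * v^-1)).
- near=> v.
  have v0 : 0 < v by near: v; apply: nbhs_pinfty_gt; exact: num_real.
  have vs : 2 * `|s| < v by near: v; apply: nbhs_pinfty_gt; exact: num_real.
  have : `|s / v| <= 1 / 2.
    rewrite normrM normfV (gtr0_norm v0) ler_pdivrMr//; lra.
  move=> /ln1D_remainder; set L := ln _ => H.
  have : `|v ^+ 2 * (L - (s / v - (s / v) ^+ 2 / 2))| <= 2 * `|s| ^+ 3 * v^-1.
    rewrite normrM ger0_norm ?sqr_ge0//.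
    apply: (le_trans (ler_wpM2l (sqr_ge0 v) H)).
    rewrite normrM normfV (gtr0_norm v0) le_eqVlt; apply/orP; left; apply/eqP.
    by field; rewrite gt_eqF.
  rewrite ler_norml (_ : _ * (L - _) = v ^+ 2 * L - v * s + s ^+ 2 / 2); last first.
    by field; rewrite gt_eqF.
  lra.
- rewrite -[X in _ --> X]subr0 -[X in _ - X](mulr0 (2 * `|s| ^+ 3)).
  apply: cvgB; first exact: cvg_cst.
  by apply: cvgMl_tmp; exact: cvgV0_pinfty.
- rewrite -[X in _ --> X]addr0 -[X in _ + X](mulr0 (2 * `|s| ^+ 3)).
  apply: cvgD; first exact: cvg_cst.
  by apply: cvgMl_tmp; exact: cvgV0_pinfty.
Unshelve. all: end_near. Qed.

(** * Gamma as a Laplace integral, and the limit of that integral *)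

Lemma Gamma_laplace (R : realType) (v : R) : 0 < v ->
  Gamma (v ^+ 2 + 1) = v `^ (2 * v ^+ 2 + 1) * expR (- v ^+ 2) *
    fine (\int[lebesgue_measure]_s (laplace_fun R v s)%:E)%E.
Proof.
move=> v0; have v20 : 0 < v ^+ 2 by rewrite exprn_gt0.
(* [c] is the maximum [(v^2)^(v^2) e^(-v^2)] of the Gamma integrand, attained at [t = v^2], times
   the Jacobian [v]. *)
set c := _ * expR _.
have c0 : 0 < c by rewrite mulr_gt0 ?powR_gt0 ?expR_gt0.
pose G (t : R) := Num.max t 0 `^ (v ^+ 2) * expR (- t).
pose F (s : R) := v ^+ 2 + v * s.
have F'E : F^`()%classic = cst v.
  apply/funext => s; rewrite derive1E.
  have dF : is_derive s 1 F v.
    by apply: is_derive_eq; rewrite /GRing.scale/=; ring.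
  exact: derive_val.
have GFE s : ((G \o F) * F^`()%classic) s = c * laplace_fun R v s.
  rewrite F'E /G /F /laplace_fun /c !fctE.
  rewrite (_ : v ^+ 2 + v * s = v ^+ 2 * (1 + s / v)); last first.
    by field; rewrite gt_eqF.
  rewrite -[X in Num.max _ X](mulr0 (v ^+ 2)) -maxr_pMr ?ltW//.
  rewrite powRM ?(ltW v20) ?le_max ?lexx ?orbT//.
  have -> : v `^ (2 * v ^+ 2 + 1) = (v ^+ 2) `^ (v ^+ 2) * v.
    rewrite powRD; last by rewrite (gt_eqF v0) implybT.
    by rewrite powRr1 ?ltW// powRrM powR_mulrn ?ltW.
  rewrite (_ : - (v ^+ 2 * (1 + s / v)) = - v ^+ 2 + - (v * s)).
    by rewrite expRD; ring.
  by field; rewrite gt_eqF.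
rewrite /Gamma /Rintegral.
transitivity (fine (\int[lebesgue_measure]_t (G t)%:E)%E).
  congr fine.
  rewrite integral_mkcond; apply: eq_integral => t _.
  rewrite /patch mem_setE in_itv/= andbT; case: ltP => t0.
    by rewrite addrK /G max_l ?ltW.
  by rewrite /G max_r// powR0 ?gt_eqF// mul0r.
rewrite (@increasing_ge0_integration_by_substitutionT R F G).
- under eq_integral do rewrite GFE EFinM.
  rewrite ge0_integralZl//=.
  (* Finiteness is not established at this point: [fine] sends both infinities to 0, and multiplying
     by [c > 0] preserves them. *)
  + case: (integral _ _ _) => [i| |] //=.
      by rewrite gt0_muley ?lte_fin//= mulr0.
    by rewrite gt0_muleNy ?lte_fin//= mulr0.
  + apply/measurable_EFinP; apply: continuous_measurable_fun.
    exact: laplace_fun_continuous.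
  + by move=> s _; rewrite lee_fin laplace_fun_ge0.
  + by rewrite lee_fin ltW.
- by move=> x y xy; rewrite ltrD2l ltr_pM2l.
- by rewrite F'E => ?; exact: cvg_cst.
- by rewrite F'E; exact: is_cvg_cst.
- by rewrite F'E; exact: is_cvg_cst.
- by move=> s; apply: derivableD => //; exact: derivableM.
- apply: (cvg_comp (fun s => v * s) (fun y => v ^+ 2 + y)); last exact: cvg_addrl_Ny.
  by apply: gt0_cvgMrNy => //; exact: cvg_id.
- apply: (cvg_comp (fun s => v * s) (fun y => v ^+ 2 + y)); last exact: cvg_addrl.
  by apply: gt0_cvgMry => //; exact: cvg_id.
- exact: powR_max0_expR_continuous.
- by move=> t; rewrite mulr_ge0 ?powR_ge0 ?expR_ge0.
Qed.

Lemma integral_laplace_fun_cvg (R : realType) :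
  fine (\int[lebesgue_measure]_s (laplace_fun R v s)%:E)%E @[v --> +oo]
  --> Num.sqrt (2 * pi : R).
Proof.
(* Truncating at 1 leaves the limit unchanged and makes the bound [laplace_fun_le] hold for every
   parameter. *)
suff H : fine (\int[lebesgue_measure]_s (laplace_fun R (Num.max v 1) s)%:E)%E
    @[v --> +oo] --> Num.sqrt (2 * pi : R).
  apply: cvg_trans H; apply: near_eq_cvg; near=> v.
  by rewrite max_l//; near: v; apply: nbhs_pinfty_ge; exact: num_real.
(* Dominated convergence is about sequences, so the limit is tested along every sequence tending to
   infinity. *)
apply/cvg_pinftyP => u uy.
have m0 n : 0 < Num.max (u n) 1 by rewrite lt_max ltr01 orbT.
have uy' : Num.max (u n) 1 @[n --> \oo] --> +oo.
  apply/cvgryPge => A; have /cvgryPge/(_ A) := uy; apply: filterS => n.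
  by rewrite le_max => ->.
apply: fine_cvg; rewrite -integralT_gauss_half.
have mE n : measurable_fun setT (EFin \o laplace_fun R (Num.max (u n) 1)).
  by apply/measurable_EFinP; apply: continuous_measurable_fun; apply: laplace_fun_continuous.
have [] := @dominated_convergence _ _ R lebesgue_measure setT measurableT
  (fun n s => (laplace_fun R (Num.max (u n) 1) s)%:E)
  (fun s => (expR (- s ^+ 2 / 2))%:E) (fun s => (expR (1 - `|s| / 2))%:E) mE _ _
  (integrable_expR_abs R) _ => //.
- apply/measurable_EFinP/measurableT_comp => //.
  by apply: measurable_funM => //; apply: measurableT_comp => //; exact: measurable_funX.
- apply: aeW => s _; apply/cvg_EFin; first exact: nearW.
  exact: (cvg_comp _ _ uy' (laplace_fun_cvg R s)).
- apply: aeW => s n _; rewrite /= ger0_norm ?laplace_fun_ge0// lee_fin.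
  by apply: laplace_fun_le; rewrite le_max lexx orbT.
Unshelve. all: end_near. Qed.

(** * Stirling's formula centred at [x + 1/2], and the theorem *)

(** Both bounds come from [ln z <= z - 1], at [1 + 1/(2x)] for the upper one and at its inverse
    [x / (x + 1/2)] for the lower one. The limit says that moving the base from [x] to [x + 1/2]
    costs a factor [e^(1/2)], which the shift in [e^(-(x + 1/2))] compensates. *)
Lemma cvg_mul_ln1D_half (R : realType) :
  (x + 1 / 2) * ln (1 + (2 * x)^-1) @[x --> +oo] --> (1 / 2 : R).
Proof.
apply: (@squeeze_cvgr _ _ _ _ (cst (1 / 2)) (fun x => 1 / 2 + 1 / 4 * x^-1)).
- near=> x.
  have x0 : 0 < x by near: x; apply: nbhs_pinfty_gt; exact: num_real.
  have x1 : 0 < x + 1 / 2 by lra.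
  have i0 : 0 < (2 * x)^-1 by rewrite invr_gt0; lra.
  rewrite /cst; apply/andP; split.
    have yE : 1 + (2 * x)^-1 = (x / (x + 1 / 2))^-1.
      by rewrite invf_div; field; rewrite gt_eqF.
    have xx0 : 0 < x / (x + 1 / 2) by rewrite divr_gt0.
    rewrite yE lnV ?posrE//.
    have := @le_ln1Dx R (x / (x + 1 / 2) - 1) ltac:(lra).
    rewrite (addrC 1) subrK => /(ler_wpM2l (ltW x1)).
    rewrite (_ : (x + 1 / 2) * (_ - 1) = - (1 / 2)); last first.
      by field; rewrite gt_eqF//; lra.
    lra.
  have := @le_ln1Dx R (2 * x)^-1 ltac:(lra) => /(ler_wpM2l (ltW x1)) /le_trans; apply.
  by rewrite le_eqVlt; apply/orP; left; apply/eqP; field; rewrite gt_eqF.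
- exact: cvg_cst.
- rewrite -[X in _ --> X]addr0 -[X in _ + X](mulr0 (1 / 4)).
  apply: cvgD; first exact: cvg_cst.
  by apply: cvgMl_tmp; exact: cvgV0_pinfty.
Unshelve. all: end_near. Qed.

Lemma cvg_sqrt_pinfty (R : realType) : Num.sqrt (x : R) @[x --> +oo] --> +oo.
Proof.
apply/cvgryPge => A; near=> x.
have Ax : A ^+ 2 <= x by near: x; apply: nbhs_pinfty_ge; exact: num_real.
by rewrite (le_trans (ler_norm A))// -sqrtr_sqr ler_wsqrtr.
Unshelve. all: end_near. Qed.

Lemma stirling_shifted (R : realType) :
  asymp_equiv (fun x : R => Gamma (x + 1))
    (fun x => Num.sqrt (2 * pi) * (x + 1 / 2) `^ (x + 1 / 2)
              * expR (- (x + 1 / 2))).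
Proof.
pose I (v : R) := fine (\int[lebesgue_measure]_s (laplace_fun R v s)%:E)%E.
have pi2 : 0 < Num.sqrt (2 * pi : R) by rewrite sqrtr_gt0 mulr_gt0 ?pi_gt0.
(* For [x > 0] this expression is exactly the quotient of the two sides. *)
have H : (Num.sqrt (2 * pi))^-1 * I (Num.sqrt x)
    * expR (1 / 2 - (x + 1 / 2) * ln (1 + (2 * x)^-1)) @[x --> +oo] --> (1 : R).
  rewrite [X in _ --> X](_ : 1 = (Num.sqrt (2 * pi))^-1 * Num.sqrt (2 * pi)
    * expR (1 / 2 - 1 / 2)); last by rewrite subrr expR0 mulVf ?gt_eqF// mulr1.
  have cI := cvg_comp _ _ (cvg_sqrt_pinfty R) (integral_laplace_fun_cvg R).
  apply: (cvgM (cvgM (cvg_cst _) cI)).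
  apply: (@continuous_cvg _ _ _ _ _ _ expR); first exact: continuous_expR.
  by apply: cvgB; [exact: cvg_cst|exact: cvg_mul_ln1D_half].
apply: cvg_trans H; apply: near_eq_cvg; near=> x.
have x0 : 0 < x by near: x; apply: nbhs_pinfty_gt; exact: num_real.
have x1 : 0 < x + 1 / 2 by lra.
have i0 : 0 < 1 + (2 * x)^-1 by rewrite addr_gt0// invr_gt0; lra.
have s0 : 0 < Num.sqrt x by rewrite sqrtr_gt0.
have lnx : ln x = ln (Num.sqrt x) *+ 2 by rewrite -lnXn// sqr_sqrtr ?ltW.
have := Gamma_laplace R (Num.sqrt x) s0; rewrite sqr_sqrtr ?ltW// -/(I _) => ->.
rewrite /powR (gt_eqF s0) (gt_eqF x1).
have -> : x + 1 / 2 = x * (1 + (2 * x)^-1) by field; rewrite gt_eqF.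
rewrite lnM ?posrE// lnx.
set l := ln (Num.sqrt x); set m := ln (1 + _).
rewrite (_ : _ * (1 + _) = x + 1 / 2); last by field; rewrite gt_eqF.
(* As [ln x = 2 l], the two contributions of [l] cancel. *)
rewrite (_ : 1 / 2 - _ = ((2 * x + 1) * l + - x)
  + - ((x + 1 / 2) * (l *+ 2 + m) + - (x + 1 / 2))); last by field.
rewrite expRD expRN !expRD invfM.
rewrite !invfM; ring.
Unshelve. all: end_near. Qed.

Theorem theorem3 (R : realType) (K : R * R -> R) (r : R -> R)
    (eps eps' : R)
    (K_mean : bivariate_mean K)
    (K_sym : symmetric_mean K)
    (K_hom : homogeneous_mean K)
    (K_diff : twice_differentiable2 K)
    (r_lim : r x @[x --> +oo] --> (0 : R))
    (eps_sum : eps + eps' = 1) :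
  asymp_equiv (fun x => Gamma (x + 1))
    (fun x => Num.sqrt (2 * pi) * (x + 1 / 2) `^ K (x + eps, x + eps')
              * expR (- (x + 1 / 2)) * expR (r x)).
Proof.
have KE := homogeneous_mean_arithmetic R K K_mean K_sym K_hom (K_diff.1 0).
(* By [eps + eps' = 1] the exponent [K (x + eps, x + eps')] is [x + 1/2], so the quotient is
   Stirling's times [e^(- r x)], which tends to 1. *)
have H : Gamma (x + 1) / (Num.sqrt (2 * pi) * (x + 1 / 2) `^ (x + 1 / 2)
    * expR (- (x + 1 / 2))) * expR (- r x) @[x --> +oo] --> (1 : R).
  rewrite [X in _ --> X](_ : 1 = 1 * expR (- 0)); last by rewrite oppr0 expR0 mulr1.
  apply: cvgM; first exact: stirling_shifted.
  apply: (@continuous_cvg _ _ _ _ _ _ expR); first exact: continuous_expR.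
  exact: cvgN.
apply: cvg_trans H; apply: near_eq_cvg; near=> x.
have -> : K (x + eps, x + eps') = x + 1 / 2 by rewrite KE; lra.
by rewrite (expRN (r x)) -[LHS]mulrA -invfM.
Unshelve. all: end_near. Qed.
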